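(* The series $\Omega_q$ is well-defined at $q=0$, and its value $\Omega_0$ at $q=0$ is the alternating sum of linear trees: $$\Omega_0=\sum_{n\ge1}(-1)^{n-1}\,\mathrm{Lnr}_n .$$
   Context: For a field $K$ ($K=\mathbb{Q}$ or $\mathbb{Q}(q)$, $q$ an indeterminate), $\mathrm{PL}=\bigoplus_{n\ge1}\mathrm{PL}_n$ is the $K$-vector space with basis the isomorphism classes of (unlabeled, non-planar) rooted trees, graded by the number $\#T$ of vertices. The pre-Lie product is $T\curvearrowleft T'=\sum_{v}$ (tree obtained from $T\sqcup T'$ by adding an edge from the root of $T'$ to $v$), sum over vertices $v$ of $T$, the root being that of $T$. Denote by $\bullet$ the one-vertex tree; $\mathrm{PL}$ is the free (right) pre-Lie algebra on $\bullet$, and a Lie algebra for $[x,y]=x\curvearrowleft y-y\curvearrowleft x$. Let $\widehat{\mathrm{PL}}=\prod_{n\ge1}\mathrm{PL}_n$ and let $\widehat U(\mathrm{PL})$ be the (degree-)completed universal enveloping algebra, with associative product $\star$. The product $\curvearrowleft$ is a right action of the Lie algebra, so extends to a right action of $\widehat U(\mathrm{PL})$ on $\widehat{\mathrm{PL}}$: $x\curvearrowleft(u\star v)=(x\curvearrowleft u)\curvearrowleft v$. Exponentials are computed in $\widehat U(\mathrm{PL})$. $\Omega\in\widehat{\mathrm{PL}}_{\mathbb{Q}}$ is the unique solution of $\bullet\curvearrowleft\left(\frac{\Omega}{\exp(\Omega)-1}\right)=\Omega$, where $\frac{x}{e^x-1}$ is expanded as a power series. For $A=\sum_{n\ge 1}A_n$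 (homogeneous components), $A[q]=\sum_n q^nA_n$. $\Omega_q\in\widehat{\mathrm{PL}}_{\mathbb{Q}(q)}$ is the unique solution of $$\Omega_q[q]\curvearrowleft(\exp(\Omega)-1)+\Omega_q[q]-\Omega_q=\bullet\curvearrowleft\Omega_q+(q-1)\bullet .$$ $\mathrm{Lnr}_n$ denotes the linear rooted tree with $n$ vertices (each vertex has at most one child). The value at $q=0$ is taken coefficientwise. *)

(* Defs.v *)
From HB Require Import structures.
From mathcomp Require Import all_boot all_order all_algebra.
From mathcomp Require Import all_classical.
From mathcomp Require Import ring zify.

Set Implicit Arguments.
Unset Strict Implicit.
Unset Printing Implicit Defensive.

Import GRing.Theory.
Local Open Scope ring_scope.
Local Open Scope quotient_scope.

(* Plane rooted trees, used as representatives of rooted trees. *)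
Inductive ptree := Node of seq ptree.

Fixpoint ptree_code (t : ptree) : GenTree.tree void :=
  let: Node s := t in GenTree.Node 0 (map ptree_code s).

Fixpoint ptree_decode (t : GenTree.tree void) : ptree :=
  if t is GenTree.Node _ s then Node (map ptree_decode s) else Node [::].

Fixpoint ptree_ind' (P : ptree -> Prop) (Q : seq ptree -> Prop)
    (HN : forall s, Q s -> P (Node s)) (H0 : Q [::])
    (HS : forall t s, P t -> Q s -> Q (t :: s)) (t : ptree) : P t :=
  let: Node s := t in
  HN s ((fix F s : Q s :=
    if s is t :: s' then HS t s' (ptree_ind' HN H0 HS t) (F s') else H0) s).

Lemma ptree_codeK : cancel ptree_code ptree_decode.
Proof.
apply: (@ptree_ind' _ (fun s => map ptree_decode (map ptree_code s) = s)).
- by move=> s /= ->.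
- by [].
- by move=> t s /= -> ->.
Qed.

HB.instance Definition _ := Countable.copy ptree (can_type ptree_codeK).

Fixpoint psize (t : ptree) : nat := let: Node s := t in (sumn (map psize s)).+1.

(* Isomorphism of rooted trees: the children of one root can be reordered so
   as to be isomorphic, one by one, to the children of the other. *)
Fixpoint iso (t u : ptree) : bool :=
  let: Node s := t in let: Node r := u in has (all2 iso s) (permutations r).

Lemma isoP s r :
  reflect (exists2 r', perm_eq r' r & all2 iso s r') (iso (Node s) (Node r)).
Proof.
apply: (iffP hasP) => -[r' hr' hs]; exists r' => //.
  by rewrite -mem_permutations.
by rewrite mem_permutations.
Qed.

Lemma all2_rel_perm (T : eqType) (r : rel T) s s' t : perm_eq s s' ->
  all2 r s t -> exists2 t', perm_eq t' t & all2 r s' t'.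
Proof.
case: s t => [|x0 s] [|y0 t] //.
  by rewrite perm_sym => /perm_nilP ->; exists [::].
move=> ps; rewrite all2E => /andP[/eqP szt az].
have /(perm_iotaP x0)[I pI ->] : perm_eq s' (x0 :: s) by rewrite perm_sym.
exists (map (nth y0 (y0 :: t)) I).
  rewrite -[X in perm_eq _ X](mkseq_nth y0) /mkseq -szt; exact: perm_map.
rewrite all2E !size_map eqxx zip_map all_map; apply/allP => i /=.
rewrite (perm_mem pI) mem_iota add0n => /= hi.
apply: (allP az (nth x0 (x0 :: s) i, nth y0 (y0 :: t) i)).
rewrite -(nth_zip x0 y0 i szt); apply: mem_nth.
by rewrite size_zip -szt minnn.
Qed.

Lemma iso_refl : reflexive iso.
Proof.
apply: (@ptree_ind' _ (fun s => all2 iso s s)) => //.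
- by move=> s hs; apply/isoP; exists s.
- by move=> t s /= -> ->.
Qed.

Lemma all2C (T : Type) (r : rel T) (s t : seq T) :
  all2 r s t = all2 (fun x y => r y x) t s.
Proof. by elim: s t => [|x s IH] [|y t] //=; rewrite IH. Qed.

Lemma iso_sym_imp t u : iso t u -> iso u t.
Proof.
move: t u.
apply: (@ptree_ind' _ (fun s => forall r, all2 iso s r -> all2 iso r s)).
- move=> s IH [r] /isoP[r' pr /IH hs]; apply/isoP.
  exact: (all2_rel_perm pr hs).
- by case.
- by move=> t s IHt IHs [|u r] //= /andP[/IHt -> /IHs ->].
Qed.

Lemma iso_trans : transitive iso.
Proof.
move=> u t v; move: t u v.
apply: (@ptree_ind' _ (fun s => forall r z, all2 iso s r -> all2 iso r z ->
  all2 iso s z)).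
- move=> s IH [r] [z] /isoP[r' pr hs] /isoP[z' pz hr]; apply/isoP.
  have pr' : perm_eq r r' by rewrite perm_sym.
  have [z2 pz2 hz2] := all2_rel_perm pr' hr.
  by exists z2; [exact: perm_trans pz2 pz | exact: IH hs hz2].
- by move=> [|//] [|//].
- move=> t s IHt IHs [|u r] [|v z] //= /andP[tu sr] /andP[uv rz].
  by rewrite (IHt _ _ tu uv) (IHs _ _ sr rz).
Qed.

Lemma iso_sym : symmetric iso.
Proof. by move=> t u; apply/idP/idP; apply: iso_sym_imp. Qed.

Canonical iso_equiv := EquivRel iso iso_refl iso_sym iso_trans.

Definition tree := {eq_quot iso}.
HB.instance Definition _ := Choice.on tree.
HB.instance Definition _ := EqQuotient.on tree.

Definition nverts (T : tree) : nat := psize (repr T).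

Definition bullet_tree : tree := \pi_tree (Node [::]).

(* The linear tree with n vertices, for n >= 1. *)
Definition Lnr (n : nat) : tree :=
  \pi_tree (iter n.-1 (fun t => Node [:: t]) (Node [::])).

(* The forests obtained from s by replacing one entry x by an element of G x. *)
Fixpoint replace1 (G : ptree -> seq ptree) (s : seq ptree) : seq (seq ptree) :=
  if s is x :: s' then
    [seq y :: s' | y <- G x] ++ [seq x :: r | r <- replace1 G s']
  else [::].

(* The trees obtained by adding an edge from the root of a to a vertex of t,
   one for each vertex of t: the root, or a vertex above one of its children. *)
Fixpoint grafts (a t : ptree) : seq ptree :=
  let: Node s := t in
  Node (a :: s) :: [seq Node r | r <- replace1 (grafts a) s].

Definition graft (T T' : tree) : seq tree :=
  [seq \pi_tree u | u <- grafts (repr T') (repr T)].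

(* The completion of PL is the space of all functions from trees to K, and the
   completion of its tensor algebra is the space of all functions from words of
   trees to K: there are finitely many trees, and words, of each degree. *)
Notation PLhat K := (tree -> K).
Notation That K := (seq tree -> K).

Section PreLie.
Variable K : fieldType.
Implicit Types (X Y : PLhat K) (u v : That K).

(* Sum of a family, coefficient by coefficient; it is meaningful when each
   coefficient is nonzero for finitely many indices only. *)
Definition csum (I : choiceType) (B : Type) (P : set I) (F : I -> B -> K) :
  B -> K := fun b => \sum_(i \in P) F i b.

Definition basis (T : tree) : PLhat K := fun S => (S == T)%:R.

Definition bullet : PLhat K := basis bullet_tree.

Definition prelie_tree (T T' : tree) : PLhat K :=
  \sum_(S <- graft T T') basis S.

Definition prelie X Y : PLhat K :=
  csum setT (fun p : tree * tree => (X p.1 * Y p.2) \*o prelie_tree p.1 p.2).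

Definition lie X Y : PLhat K := prelie X Y - prelie Y X.

Definition wsize (w : seq tree) : nat := sumn (map nverts w).

Definition tone : That K := fun w => (w == [::])%:R.

Definition tmul u v : That K :=
  fun w => \sum_(i < (size w).+1) u (take i w) * v (drop i w).

Definition tpow u (n : nat) : That K := iter n (tmul u) tone.

Definition tinj X : That K := fun w => if w is [:: T] then X T else 0.

Definition lie_relator (x y : PLhat K) : That K :=
  tmul (tinj x) (tinj y) - tmul (tinj y) (tinj x) - tinj (lie x y).

(* Closure, for the topology given by the degree, of the two-sided ideal
   generated by the elements x y - y x - [x, y]. *)
Definition Uideal (u : That K) : bool :=
  `[< forall n, exists r : seq (That K * PLhat K * PLhat K * That K),
      forall w, (wsize w <= n)%N ->
      u w = (\sum_(p <- r)
        tmul (tmul p.1.1.1 (lie_relator p.1.1.2 p.1.2)) p.2) w >].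

Lemma tmulNl u v : tmul (- u) v = - tmul u v.
Proof.
apply/funext => w; transitivity (- tmul u v w); last by [].
rewrite /tmul -sumrN.
by apply: eq_bigr => i _; rewrite mulNr.
Qed.

Lemma Uideal_zmod_closed : zmod_closed Uideal.
Proof.
split; first by apply/asboolP => n; exists [::] => w _; rewrite big_nil.
move=> u v /asboolP hu /asboolP hv; apply/asboolP => n.
have [r hr] := hu n; have [s hs] := hv n.
exists (r ++ [seq (- p.1.1.1, p.1.1.2, p.1.2, p.2) | p <- s]) => w hw.
rewrite [LHS]/(u w - v w) hr // hs // !fct_sumE big_cat big_map -sumrN.
by congr (_ + _); apply: eq_bigr => p _ /=; rewrite !tmulNl.
Qed.

HB.instance Definition _ :=
  GRing.isZmodClosed.Build (That K) Uideal Uideal_zmod_closed.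

(* The completed universal enveloping algebra, as a quotient of the completed
   tensor algebra. Its product is induced by tmul, so that the class of a power
   series in an element of PL is the power series computed in the quotient. *)
Definition Uhat : zmodType :=
  Quotient.quot (GRing.ZmodClosed.clone (That K) Uideal _).

Definition Uone : Uhat := \pi_Uhat tone.

(* The class of the power series c_0 + c_1 X + c_2 X^2 + ... *)
Definition Useries (c : nat -> K) X : Uhat :=
  \pi_Uhat (csum setT (fun n => c n \*o tpow (tinj X) n)).

Definition Uexp X : Uhat := Useries (fun n => n`!%:R^-1) X.

(* Coefficients of x / (exp x - 1), see toddP. *)
Fixpoint todds (n : nat) : seq K :=
  if n is m.+1 then
    let s := todds m in
    rcons s ((m == 0)%:R - \sum_(i < m) s`_i / (m - i).+1`!%:R)
  else [::].

Definition todd (n : nat) : K := (todds n.+1)`_n.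

Lemma toddP n :
  \sum_(i < n.+1) todd i / (n - i).+1`!%:R = (n == 0)%:R.
Proof.
have sz m : size (todds m) = m by elim: m => //= m IH; rewrite size_rcons IH.
have nthE m i : (i < m)%N -> (todds m)`_i = todd i.
  elim: m => // m IH; rewrite ltnS leq_eqVlt => /predU1P[-> //|im] /=.
  by rewrite nth_rcons sz im IH.
rewrite big_ord_recr /= subnn divr1 {2}/todd /= nth_rcons sz ltnn eqxx.
rewrite (eq_bigr (fun i : 'I_n => (todds n)`_i / (n - i).+1`!%:R)).
  by rewrite addrC subrK.
by move=> i _; rewrite nthE.
Qed.

(* The right action on PL of words, of the completed tensor algebra (it is an
   action by act_tensor_mul), and of its quotient (it is well defined by
   act_pi). *)
Definition act_word X (w : seq tree) : PLhat K :=
  foldl (fun Y T => prelie Y (basis T)) X w.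

Definition act_tensor X u : PLhat K :=
  csum setT (fun w => u w \*o act_word X w).

Definition act X (a : Uhat) : PLhat K := act_tensor X (repr a).

End PreLie.

Section PlaneGrafts.
Variable V : zmodType.
Implicit Types (a b t u : ptree) (s r : seq ptree).
Implicit Types (phi : ptree -> V) (psi : seq ptree -> V).

Definition iso_inv phi := forall t u, iso t u -> phi t = phi u.
Definition all2_iso_inv psi := forall s r, all2 iso s r -> psi s = psi r.

Definition gsum a t phi : V := \sum_(u <- grafts a t) phi u.
Definition fgsum a s psi : V := \sum_(r <- replace1 (grafts a) s) psi r.

Lemma gsum_node a s phi :
  gsum a (Node s) phi = phi (Node (a :: s)) + fgsum a s (phi \o Node).
Proof. by rewrite /gsum /fgsum /= big_cons big_map. Qed.

Lemma fgsum_nil a psi : fgsum a [::] psi = 0.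
Proof. exact: big_nil. Qed.

Lemma fgsum_cons a x s psi :
  fgsum a (x :: s) psi =
  gsum a x (fun y => psi (y :: s)) + fgsum a s (fun r => psi (x :: r)).
Proof. by rewrite /fgsum /= big_cat !big_map. Qed.

Lemma eq_gsum a t phi phi' : phi =1 phi' -> gsum a t phi = gsum a t phi'.
Proof. by move=> e; apply: eq_bigr. Qed.

Lemma eq_fgsum a s psi psi' : psi =1 psi' -> fgsum a s psi = fgsum a s psi'.
Proof. by move=> e; apply: eq_bigr. Qed.

Lemma fgsum_cat a s1 s2 psi :
  fgsum a (s1 ++ s2) psi =
  fgsum a s1 (fun r => psi (r ++ s2)) + fgsum a s2 (fun r => psi (s1 ++ r)).
Proof.
elim: s1 psi => [|x s1 IH] psi; first by rewrite fgsum_nil add0r.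
by rewrite /= !fgsum_cons IH addrA.
Qed.

Lemma fgsum_perm a s r psi : (forall s r, perm_eq s r -> psi s = psi r) ->
  perm_eq s r -> fgsum a s psi = fgsum a r psi.
Proof.
move=> hpsi psr; pose P z := fgsum a s psi = fgsum a z psi.
apply: (@catCA_perm_ind _ P _ _ _ psr erefl) => s1 s2 s3; rewrite /P => ->.
rewrite !fgsum_cat addrCA; congr (_ + (_ + _)).
- by apply: eq_fgsum => z; apply: hpsi; rewrite perm_catCA.
- by apply: eq_fgsum => z; apply: hpsi; rewrite perm_catCA.
- by apply: eq_fgsum => z; apply: hpsi; rewrite perm_catCA.
Qed.

Lemma all2_iso_refl s : all2 iso s s.
Proof. by elim: s => //= x s ->; rewrite iso_refl. Qed.

Lemma iso_inv_cons psi s :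
  all2_iso_inv psi -> iso_inv (fun y => psi (y :: s)).
Proof. by move=> h t u tu; apply: h => /=; rewrite tu all2_iso_refl. Qed.

Lemma all2_iso_inv_cons psi x :
  all2_iso_inv psi -> all2_iso_inv (fun r => psi (x :: r)).
Proof. by move=> h s r sr; apply: h => /=; rewrite iso_refl. Qed.

Lemma iso_inv_Node phi : iso_inv phi -> all2_iso_inv (phi \o Node).
Proof. by move=> h s r sr; apply: h; apply/isoP; exists r. Qed.

Lemma iso_perm s r : perm_eq s r -> iso (Node s) (Node r).
Proof. by move=> sr; apply/isoP; exists s => //; exact: all2_iso_refl. Qed.

Lemma gsum_isol a b t phi : iso a b -> iso_inv phi ->
  gsum a t phi = gsum b t phi.
Proof.
move=> ab; move: t phi.
apply: (@ptree_ind' _ (fun s => forall psi, all2_iso_inv psi ->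
  fgsum a s psi = fgsum b s psi)).
- move=> s IH phi h; rewrite !gsum_node (IH _ (iso_inv_Node h)); congr (_ + _).
  by apply: h; apply/isoP; exists (b :: s) => //=; rewrite ab all2_iso_refl.
- by move=> psi _; rewrite !fgsum_nil.
- move=> t s IHt IHs psi h; rewrite !fgsum_cons.
  by rewrite (IHt _ (iso_inv_cons _ h)) (IHs _ (all2_iso_inv_cons _ h)).
Qed.

Lemma gsum_isor a t u phi : iso t u -> iso_inv phi ->
  gsum a t phi = gsum a u phi.
Proof.
move: t u phi.
apply: (@ptree_ind' _ (fun s => forall r psi, all2 iso s r ->
  all2_iso_inv psi -> fgsum a s psi = fgsum a r psi)).
- move=> s IH [r] phi tu h; rewrite !gsum_node; congr (_ + _).
    apply: h; move: tu => /isoP[r' pr sr]; apply/isoP.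
    by exists (a :: r'); rewrite ?perm_cons //= iso_refl.
  move: tu => /isoP[r' pr sr]; rewrite (IH _ _ sr (iso_inv_Node h)).
  by apply: fgsum_perm => // s1 s2 /iso_perm; apply: h.
- by case.
- move=> t s IHt IHs [|u r] psi //= /andP[tu sr] h; rewrite !fgsum_cons.
  rewrite (IHt _ _ tu (iso_inv_cons _ h)) (IHs _ _ sr (all2_iso_inv_cons _ h)).
  congr (_ + _); first apply: eq_gsum => y.
    by apply: h => /=; rewrite iso_refl.
  by apply: eq_fgsum => z; apply: h => /=; rewrite tu all2_iso_refl.
Qed.

Lemma gsumD a t phi phi' :
  gsum a t (fun u => phi u + phi' u) = gsum a t phi + gsum a t phi'.
Proof. exact: big_split. Qed.

Lemma fgsumD a s psi psi' :
  fgsum a s (fun r => psi r + psi' r) = fgsum a s psi + fgsum a s psi'.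
Proof. exact: big_split. Qed.

Definition gassoc a b t phi : V :=
  gsum a t (fun u => gsum b u phi) - gsum b a (fun c => gsum c t phi).

Definition fgassoc a b s psi : V :=
  fgsum a s (fun r => fgsum b r psi) - gsum b a (fun c => fgsum c s psi).

Lemma gassoc_node a b s phi : gassoc a b (Node s) phi =
  phi (Node (b :: a :: s)) + (fgsum b s (fun r => phi (Node (a :: r)))
  + fgsum a s (fun r => phi (Node (b :: r)))) + fgassoc a b s (phi \o Node).
Proof.
rewrite /gassoc gsum_node gsum_node fgsum_cons.
rewrite (eq_fgsum a s (fun r => gsum_node b r phi)).
rewrite (eq_gsum b a (fun c => gsum_node c s phi)) fgsumD gsumD /fgassoc /=.
set A := gsum b a (fun c => phi (Node (c :: s))); set F := phi _.
rewrite [F + _]addrCA -[A + _ + _]addrA opprD addrACA subrr add0r.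
by rewrite !addrA.
Qed.

Lemma fgassoc_cons a b x s psi : fgassoc a b (x :: s) psi =
  gassoc a b x (fun y => psi (y :: s)) + fgassoc a b s (fun r => psi (x :: r))
  + (gsum a x (fun y => fgsum b s (fun r => psi (y :: r)))
     + gsum b x (fun y => fgsum a s (fun r => psi (y :: r)))).
Proof.
rewrite /fgassoc fgsum_cons (eq_gsum a x (fun y => fgsum_cons b y s psi)).
rewrite (eq_fgsum a s (fun r => fgsum_cons b x r psi)).
rewrite (eq_gsum b a (fun c => fgsum_cons c x s psi)) !fgsumD !gsumD /gassoc.
have -> : fgsum a s (fun r => gsum b x (fun y => psi (y :: r))) =
  gsum b x (fun y => fgsum a s (fun r => psi (y :: r))) by exact: exchange_big.
rewrite opprD -!addrA; congr (_ + _).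
by rewrite addrA addrC [_ + (- _ - _)]addrCA -!addrA.
Qed.

Lemma gassocC a b t phi : iso_inv phi -> gassoc a b t phi = gassoc b a t phi.
Proof.
move: t phi.
apply: (@ptree_ind' _ (fun s => forall psi, all2_iso_inv psi ->
  fgassoc a b s psi = fgassoc b a s psi)).
- move=> s IH phi h; rewrite !gassoc_node (IH _ (iso_inv_Node h)).
  congr (_ + _ + _); last by rewrite addrC.
  by apply: h; apply: iso_perm; rewrite (perm_catCA [:: b] [:: a]).
- by move=> psi _; rewrite /fgassoc !fgsum_nil /gsum !big1 // => c _; exact: fgsum_nil.
- move=> t s IHt IHs psi h; rewrite !fgassoc_cons.
  rewrite (IHt _ (iso_inv_cons _ h)) (IHs _ (all2_iso_inv_cons _ h)).
  by congr (_ + _); rewrite addrC.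
Qed.

End PlaneGrafts.

Lemma psize_gt0 t : (0 < psize t)%N. Proof. by case: t. Qed.

Lemma iso_psize t u : iso t u -> psize t = psize u.
Proof.
move: t u; apply: (@ptree_ind' _ (fun s => forall r, all2 iso s r ->
  sumn (map psize s) = sumn (map psize r))).
- move=> s IH [r] /isoP[r' pr /IH /= ->].
  by congr _.+1; apply: perm_sumn; exact: perm_map.
- by case.
- by move=> t s IHt IHs [|u r] //= /andP[/IHt -> /IHs ->].
Qed.

Lemma iso_repr t : iso (repr (\pi_tree t)) t.
Proof. by apply/eqmodP; rewrite reprK. Qed.

Lemma nverts_pi t : nverts (\pi_tree t) = psize t.
Proof. exact: iso_psize (iso_repr t). Qed.

Lemma nverts_gt0 T : (0 < nverts T)%N. Proof. exact: psize_gt0. Qed.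

Lemma size_grafts a t : size (grafts a t) = psize t.
Proof.
move: t; apply: (@ptree_ind' _ (fun s =>
  size (replace1 (grafts a) s) = sumn (map psize s))) => //.
- by move=> s IH; rewrite /= size_map IH.
- by move=> t s IHt IHs; rewrite /= size_cat !size_map IHt IHs.
Qed.

Lemma psize_grafts a t u : u \in grafts a t -> psize u = (psize t + psize a)%N.
Proof.
move: t u; apply: (@ptree_ind' _ (fun s => forall r,
  r \in replace1 (grafts a) s ->
  sumn (map psize r) = (sumn (map psize s) + psize a)%N)) => //.
- move=> s IH u; rewrite /= inE => /predU1P[->/=|/mapP[r /IH e ->]].
    by rewrite addnC addSn.
  by rewrite /= e addSn.
- move=> t s IHt IHs r; rewrite /= mem_cat => /orP[] /mapP[].
    by move=> y /IHt e -> /=; rewrite e addnAC.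
  by move=> y /IHs e -> /=; rewrite e addnA.
Qed.

Lemma seq_finite (T : eqType) (r : seq T) n : exists l : seq (seq T),
  forall s, (size s <= n)%N -> {subset s <= r} -> s \in l.
Proof.
elim: n => [|n [l IH]].
  by exists [:: [::]] => -[].
exists ([::] :: [seq x :: s | x <- r, s <- l]) => -[//|x s] /= hs sr.
rewrite inE; apply/orP; right; apply/allpairsP; exists (x, s); split => //=.
  by apply: sr; rewrite inE eqxx.
by apply: IH => // y ys; apply: sr; rewrite inE ys orbT.
Qed.

Lemma sumn_map_ge (T : eqType) (f : T -> nat) s x :
  x \in s -> (f x <= sumn (map f s))%N.
Proof.
elim: s => //= y s IH; rewrite inE => /predU1P[->|/IH]; first exact: leq_addr.
by move=> /leq_trans -> //; exact: leq_addl.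
Qed.

Lemma sumn_map_size (T : Type) (f : T -> nat) s : (forall x, 0 < f x)%N ->
  (size s <= sumn (map f s))%N.
Proof. by move=> f0; elim: s => //= x s IH; rewrite -addn1 addnC leq_add. Qed.

Lemma ptree_finite n : exists l : seq ptree, forall t, (psize t <= n)%N -> t \in l.
Proof.
elim: n => [|n [l IH]]; first by exists [::] => t; rewrite leqNgt psize_gt0.
have [r hr] := seq_finite l n; exists (map Node r) => -[s] /= hs.
apply: map_f; apply: hr.
  exact: leq_trans (sumn_map_size _ psize_gt0) hs.
by move=> t /(sumn_map_ge psize) h; apply: IH; exact: leq_trans h hs.
Qed.

Lemma trees_subproof n : exists l : seq tree,
  uniq l /\ forall T, (T \in l) = (nverts T <= n)%N.
Proof.
have [l hl] := ptree_finite n.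
exists (undup [seq T <- map \pi_tree l | nverts T <= n]%N).
split; first exact: undup_uniq.
move=> T; rewrite mem_undup mem_filter andb_idr // => hT.
by rewrite -[T]reprK; apply: map_f; exact: hl.
Qed.

Definition trees n : seq tree := sval (cid (trees_subproof n)).
Lemma trees_uniq n : uniq (trees n).
Proof. by rewrite /trees; case: cid => l []. Qed.
Lemma mem_trees n T : (T \in trees n) = (nverts T <= n)%N.
Proof. by rewrite /trees; case: cid => l []. Qed.

Lemma wsize_size w : (size w <= wsize w)%N.
Proof. exact: sumn_map_size nverts_gt0. Qed.

Lemma wsize_cat a b : wsize (a ++ b) = (wsize a + wsize b)%N.
Proof. by rewrite /wsize map_cat sumn_cat. Qed.

Lemma words_subproof n : exists l : seq (seq tree),
  uniq l /\ forall w, (w \in l) = (wsize w <= n)%N.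
Proof.
have [l hl] := seq_finite (trees n) n.
exists (undup [seq w <- l | wsize w <= n]%N); split; first exact: undup_uniq.
move=> w; rewrite mem_undup mem_filter andb_idr // => hw; apply: hl.
  exact: leq_trans (wsize_size _) hw.
by move=> T /(sumn_map_ge nverts) h; rewrite mem_trees; exact: leq_trans h hw.
Qed.

Definition words n : seq (seq tree) := sval (cid (words_subproof n)).
Lemma words_uniq n : uniq (words n).
Proof. by rewrite /words; case: cid => l []. Qed.
Lemma mem_words n w : (w \in words n) = (wsize w <= n)%N.
Proof. by rewrite /words; case: cid => l []. Qed.

Section Linear.
Variable K : fieldType.
Implicit Types (X Y Z : PLhat K) (u v : That K).

Lemma csumE (I : choiceType) (B : Type) (r : seq I) (F : I -> B -> K) b :
  uniq r -> (forall i, i \notin r -> F i b = 0) ->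
  csum setT F b = \sum_(i <- r) F i b.
Proof.
move=> ur h; rewrite /csum (fsbigE r) //; last by move=> i _; exact: h.
by apply: eq_bigl => i; rewrite in_setT.
Qed.

Definition mult (A B S : tree) : K := prelie_tree K A B S.

Lemma multE A B S :
  mult A B S = gsum (repr B) (repr A) (fun t => (S == \pi_tree t)%:R).
Proof. by rewrite /mult /prelie_tree fct_sumE /graft big_map. Qed.

Lemma mult_eq0 A B S : (nverts A + nverts B != nverts S)%N -> mult A B S = 0.
Proof.
move=> h; rewrite multE /gsum big_seq big1 // => t /psize_grafts e.
case: eqP => // eS; move: h; rewrite eS nverts_pi e.
by rewrite eqxx.
Qed.

Lemma prelieE n X Y S : (nverts S <= n)%N ->
  prelie X Y S =
  \sum_(A <- trees n) \sum_(B <- trees n) X A * Y B * mult A B S.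
Proof.
move=> hn; rewrite /prelie (@csumE _ _ [seq (A, B) | A <- trees n, B <- trees n]).
- by rewrite big_allpairs.
- by apply: allpairs_uniq; rewrite ?trees_uniq // => -[? ?] [? ?].
- move=> [A B] /=; rewrite -/(mult A B S) => h.
  rewrite [mult _ _ _]mult_eq0 ?mulr0 //; apply: contra h => /eqP h.
  by apply/allpairsP; exists (A, B); rewrite !mem_trees /=; split => //; lia.
Qed.

Lemma mult_sum n A B (f : tree -> K) : 
  (forall S, ~~ (nverts S <= n)%N -> f S = 0) ->
  \sum_(S <- trees n) mult A B S * f S =
  gsum (repr B) (repr A) (fun t => f (\pi_tree t)).
Proof.
move=> hf; under eq_bigr do rewrite multE /gsum mulr_suml.
rewrite exchange_big; apply: eq_bigr => t _ /=.
have [tn|tn] := boolP (psize t <= n)%N.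
  rewrite (bigD1_seq (\pi_tree t)) ?trees_uniq ?mem_trees ?nverts_pi //=.
  by rewrite eqxx mul1r big1 ?addr0 // => S /negbTE ->; rewrite mul0r.
rewrite hf ?nverts_pi // big_seq big1 // => S; rewrite mem_trees => hS.
by case: eqP => [e|]; rewrite ?mul0r //; move: tn; rewrite -nverts_pi -e hS.
Qed.

Definition delta_pi S : ptree -> K := fun t => (S == \pi_tree t)%:R.

Lemma delta_pi_inv S : iso_inv (delta_pi S).
Proof. by move=> t u tu; rewrite /delta_pi; congr ((_ == _)%:R); apply/eqmodP. Qed.

Lemma gsum_pi_inv (a : ptree) (phi : ptree -> K) :
  iso_inv phi -> iso_inv (fun t => gsum a t phi).
Proof. by move=> h t u tu; exact: gsum_isor. Qed.

Lemma mult_left n A B C S : (nverts S <= n)%N ->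
  \sum_(E <- trees n) mult A B E * mult E C S =
  gsum (repr B) (repr A) (fun t => gsum (repr C) t (delta_pi S)).
Proof.
move=> hn; rewrite (@mult_sum n A B (fun E => mult E C S)).
  apply: eq_gsum => t; rewrite multE; apply: gsum_isor; first exact: iso_repr.
  exact: delta_pi_inv.
by move=> E hE; apply: mult_eq0; apply: contra hE => /eqP h; lia.
Qed.

Lemma mult_right n A B C S : (nverts S <= n)%N ->
  \sum_(E <- trees n) mult B C E * mult A E S =
  gsum (repr C) (repr B) (fun t => gsum t (repr A) (delta_pi S)).
Proof.
move=> hn; rewrite (@mult_sum n B C (fun E => mult A E S)).
  apply: eq_gsum => t; rewrite multE; apply: gsum_isol; first exact: iso_repr.
  exact: delta_pi_inv.
by move=> E hE; apply: mult_eq0; apply: contra hE => /eqP h; lia.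
Qed.

Lemma prelie_assocE X Y Z S n : (nverts S <= n)%N ->
  prelie (prelie X Y) Z S - prelie X (prelie Y Z) S =
  \sum_(A <- trees n) \sum_(B <- trees n) \sum_(C <- trees n)
    X A * Y B * Z C * gassoc (repr B) (repr C) (repr A) (delta_pi S).
Proof.
move=> hn; rewrite !(prelieE _ _ hn).
have -> : \sum_(E <- trees n) \sum_(C <- trees n)
    prelie X Y E * Z C * mult E C S =
  \sum_(A <- trees n) \sum_(B <- trees n) \sum_(C <- trees n)
    X A * Y B * Z C * gsum (repr B) (repr A)
      (fun t => gsum (repr C) t (delta_pi S)).
  under [RHS]eq_bigr do under eq_bigr do under eq_bigr do
    rewrite -(mult_left _ _ _ hn) mulr_sumr.
  transitivity (\sum_(E <- trees n) \sum_(C <- trees n) \sum_(A <- trees n)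
     \sum_(B <- trees n) X A * Y B * Z C * (mult A B E * mult E C S)).
    apply: eq_big_seq => E; rewrite mem_trees => hE; apply: eq_bigr => C _.
    rewrite (prelieE _ _ hE) !mulr_suml; apply: eq_bigr => A _.
    by rewrite !mulr_suml; apply: eq_bigr => B _; ring.
  rewrite exchange_big; under eq_bigr do rewrite exchange_big.
  rewrite exchange_big; apply: eq_bigr => A _.
  under eq_bigr do rewrite exchange_big.
  by rewrite exchange_big; apply: eq_bigr => B _; apply: eq_bigr => C _.
have -> : \sum_(A <- trees n) \sum_(E <- trees n)
    X A * prelie Y Z E * mult A E S =
  \sum_(A <- trees n) \sum_(B <- trees n) \sum_(C <- trees n)
    X A * Y B * Z C * gsum (repr C) (repr B)
      (fun t => gsum t (repr A) (delta_pi S)).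
  apply: eq_bigr => A _.
  under [RHS]eq_bigr do under eq_bigr do
    rewrite -(mult_right _ _ _ hn) mulr_sumr.
  transitivity (\sum_(E <- trees n) \sum_(B <- trees n) \sum_(C <- trees n)
     X A * Y B * Z C * (mult B C E * mult A E S)).
    apply: eq_big_seq => E; rewrite mem_trees => hE.
    rewrite (prelieE _ _ hE) mulr_sumr mulr_suml; apply: eq_bigr => B _.
    by rewrite mulr_sumr !mulr_suml; apply: eq_bigr => C _; ring.
  rewrite exchange_big; apply: eq_bigr => B _.
  by rewrite exchange_big; apply: eq_bigr => C _.
rewrite -sumrB; apply: eq_bigr => A _; rewrite -sumrB; apply: eq_bigr => B _.
by rewrite -sumrB; apply: eq_bigr => C _; rewrite /gassoc mulrBr.
Qed.

Lemma prelie_assoc_sym X Y Z :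
  prelie (prelie X Y) Z - prelie X (prelie Y Z) =
  prelie (prelie X Z) Y - prelie X (prelie Z Y).
Proof.
apply/funext => S.
transitivity (prelie (prelie X Y) Z S - prelie X (prelie Y Z) S) => //.
transitivity (prelie (prelie X Z) Y S - prelie X (prelie Z Y) S) => //.
rewrite !(prelie_assocE _ _ _ (leqnn _)); apply: eq_bigr => A _.
rewrite exchange_big; apply: eq_bigr => C _; apply: eq_bigr => B _.
by rewrite (gassocC _ _ _ (@delta_pi_inv S)); ring.
Qed.

Definition low d X := forall A, (nverts A <= d)%N -> X A = 0.

Lemma prelie_low d X T : low d X -> low (d + nverts T) (prelie X (basis K T)).
Proof.
move=> h S hS; rewrite (prelieE _ _ (leqnn _)) big1 // => A _.
rewrite big1 // => B _; rewrite /basis; case: eqP => [->|]; last by rewrite mulr0 mul0r.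
have [hA|hA] := leqP (nverts A) d; first by rewrite h // !mul0r.
by rewrite mult_eq0 ?mulr0 //; apply/eqP => e; lia.
Qed.

Lemma act_word_low d X w : low d X -> low (d + wsize w) (act_word X w).
Proof.
rewrite /act_word /wsize; elim: w d X => [|T w IH] d X h /=; first by rewrite addn0.
by rewrite addnA; apply: IH; exact: prelie_low.
Qed.

Lemma act_word_eq0 X w S : (nverts S <= wsize w)%N -> act_word X w S = 0.
Proof.
move=> h; apply: (@act_word_low 0) h => A hA.
by have := nverts_gt0 A; rewrite ltnNge hA.
Qed.

Lemma act_tensorE n X u S : (nverts S <= n)%N ->
  act_tensor X u S = \sum_(w <- words n) u w * act_word X w S.
Proof.
move=> hn; rewrite /act_tensor (csumE (words_uniq n)) // => w.
rewrite mem_words -ltnNge => hw /=; rewrite act_word_eq0 ?mulr0 //.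
exact: ltnW (leq_ltn_trans hn hw).
Qed.

Lemma act_tensorB X u v : act_tensor X (u - v) = act_tensor X u - act_tensor X v.
Proof.
apply/funext => S; transitivity (act_tensor X u S - act_tensor X v S) => //.
rewrite !(act_tensorE _ _ (leqnn _)) -sumrB; apply: eq_bigr => w _.
exact: mulrBl.
Qed.

Lemma act_tensor_sum I (r : seq I) X (F : I -> That K) :
  act_tensor X (\sum_(i <- r) F i) = \sum_(i <- r) act_tensor X (F i).
Proof.
apply/funext => S; rewrite [in RHS]fct_sumE (act_tensorE _ _ (leqnn _)).
under [RHS]eq_bigr do rewrite (act_tensorE _ _ (leqnn _)).
rewrite exchange_big; apply: eq_bigr => w _ /=.
by rewrite fct_sumE mulr_suml.
Qed.

Lemma act_tensor_low_eq X u v S :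
  (forall w, (wsize w <= nverts S)%N -> u w = v w) ->
  act_tensor X u S = act_tensor X v S.
Proof.
move=> h; rewrite !(act_tensorE _ _ (leqnn _)); apply: eq_big_seq => w.
by rewrite mem_words => /h ->.
Qed.

Lemma act_tensor0l u : act_tensor 0 u = 0.
Proof.
apply/funext => S; rewrite (act_tensorE _ _ (leqnn _)) big1 // => w _.
by rewrite (@act_word_low (nverts S) 0 w) ?mulr0 ?leq_addr.
Qed.

Lemma prelie_basis_sum I (r : seq I) (f : I -> K) (F : I -> PLhat K) X T n :
  (forall S, (nverts S <= n)%N -> X S = \sum_(i <- r) f i * F i S) ->
  forall S, (nverts S <= n)%N ->
    prelie X (basis K T) S = \sum_(i <- r) f i * prelie (F i) (basis K T) S.
Proof.
move=> h S hS; rewrite (prelieE _ _ hS).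
under [RHS]eq_bigr do rewrite (prelieE _ _ hS) mulr_sumr.
rewrite [RHS]exchange_big; apply: eq_big_seq => A; rewrite mem_trees => hA /=.
under [RHS]eq_bigr do rewrite mulr_sumr.
rewrite [RHS]exchange_big; apply: eq_bigr => B _ /=.
by rewrite (h _ hA) !mulr_suml; apply: eq_bigr => i _; ring.
Qed.

Lemma act_word_sum I (r : seq I) (f : I -> K) (F : I -> PLhat K) X w n :
  (forall S, (nverts S <= n)%N -> X S = \sum_(i <- r) f i * F i S) ->
  forall S, (nverts S <= n)%N ->
    act_word X w S = \sum_(i <- r) f i * act_word (F i) w S.
Proof.
rewrite /act_word; elim: w X F => [//|T w IH] X F h S hS /=.
apply: (IH _ (fun i => prelie (F i) (basis K T))) hS => S' hS'.
exact: prelie_basis_sum hS'.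
Qed.

Lemma act_word_cat X a b : act_word X (a ++ b) = act_word (act_word X a) b.
Proof. exact: foldl_cat. Qed.

Lemma words_split n (w : seq tree) (g : seq tree -> seq tree -> K) :
  (wsize w <= n)%N ->
  \sum_(i < (size w).+1) g (take i w) (drop i w) =
  \sum_(a <- words n) \sum_(b <- words n | a ++ b == w) g a b.
Proof.
move=> hw; under [RHS]eq_bigr do rewrite big_mkcond.
rewrite -(big_allpairs (F := fun p => if p.1 ++ p.2 == w then g p.1 p.2 else 0)).
rewrite -big_mkcond /=.
rewrite -(big_mkord xpredT (fun i => g (take i w) (drop i w))).
rewrite -(big_map (fun i => (take i w, drop i w)) xpredT (fun p => g p.1 p.2)).
rewrite -[RHS]big_filter; apply: perm_big; apply: uniq_perm.
- rewrite map_inj_in_uniq ?iota_uniq // => i j.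
  rewrite !mem_index_iota /= !ltnS => hi hj [/(congr1 size) + _].
  by rewrite !size_take_min !(minn_idPl _).
- by rewrite filter_uniq // allpairs_uniq ?words_uniq // => -[? ?] [? ?].
move=> [a b]; rewrite mem_filter; apply/mapP/andP => [[i]|[/eqP e _]].
  move=> hi [-> ->]; rewrite cat_take_drop; split => //.
  apply/allpairsP; exists (take i w, drop i w); rewrite !mem_words /=.
  by move: hw; rewrite -{1}(cat_take_drop i w) wsize_cat => hw; split => //; lia.
exists (size a).
  by rewrite mem_index_iota /= -e size_cat ltnS leq_addr.
by rewrite -e take_size_cat // drop_size_cat.
Qed.

Lemma act_tensor_mul X u v :
  act_tensor X (tmul u v) = act_tensor (act_tensor X u) v.
Proof.
apply/funext => S; set n := nverts S.
rewrite !(act_tensorE _ _ (leqnn _)) -/n.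
have -> : \sum_(b <- words n) v b * act_word (act_tensor X u) b S =
  \sum_(b <- words n) \sum_(a <- words n) u a * v b * act_word X (a ++ b) S.
  apply: eq_bigr => b _.
  rewrite (@act_word_sum _ (words n) u (act_word X) _ b n _ S (leqnn _)); last first.
    by move=> S' hS'; exact: act_tensorE.
  rewrite mulr_sumr; apply: eq_bigr => a _; rewrite act_word_cat; ring.
rewrite exchange_big /=.
transitivity (\sum_(w <- words n) \sum_(a <- words n)
    \sum_(b <- words n | a ++ b == w) u a * v b * act_word X (a ++ b) S).
  apply: eq_big_seq => w; rewrite mem_words => hw.
  rewrite /tmul (words_split (fun a b => u a * v b) hw) mulr_suml.
  apply: eq_bigr => a _; rewrite mulr_suml.
  by apply: eq_bigr => b /eqP ->.
rewrite exchange_big; apply: eq_bigr => a _ /=.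
under eq_bigr do rewrite big_mkcond.
rewrite exchange_big; apply: eq_bigr => b _ /=; rewrite -big_mkcond /=.
have [hab|hab] := boolP (a ++ b \in words n).
  rewrite (eq_bigl (pred1 (a ++ b))); last by move=> w; rewrite eq_sym.
  by rewrite -big_filter filter_pred1_uniq ?words_uniq // big_seq1.
rewrite act_word_eq0 ?mulr0; last by move: hab; rewrite mem_words -ltnNge => /ltnW.
by rewrite big1.
Qed.

Lemma act_tinj X Y : act_tensor X (tinj Y) = prelie X Y.
Proof.
apply/funext => S; set n := nverts S.
rewrite /act_tensor (@csumE _ _ [seq [:: T] | T <- trees n]).
- rewrite big_map (prelieE _ _ (leqnn _)) -/n exchange_big.
  apply: eq_big_seq => T; rewrite mem_trees => hT /=.
  rewrite (prelieE _ _ (leqnn _)) -/n mulr_sumr; apply: eq_bigr => A _.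
  rewrite (bigD1_seq T) ?trees_uniq ?mem_trees //= big1 => [|B /negbTE hB].
    by rewrite addr0 /basis eqxx mulr1 mulrCA mulrA.
  by rewrite /basis hB mulr0 mul0r.
- by rewrite map_inj_uniq ?trees_uniq // => ? ? [].
move=> [|T [|? ?]] //= h; rewrite ?mul0r //.
rewrite -[prelie _ _]/(act_word X [:: T]) act_word_eq0 ?mulr0 //.
rewrite /wsize /= addn0; apply: contraR h; rewrite -ltnNge => /ltnW h.
by apply: map_f; rewrite mem_trees.
Qed.

Lemma act_lie_relator X Y Z : act_tensor X (lie_relator Y Z) = 0.
Proof.
rewrite /lie_relator !act_tensorB !act_tensor_mul !act_tinj.
have := prelie_assoc_sym X Y Z; rewrite /lie.
have -> : prelie X (prelie Y Z - prelie Z Y) =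
    prelie X (prelie Y Z) - prelie X (prelie Z Y).
  apply/funext => S.
  transitivity (prelie X (prelie Y Z) S - prelie X (prelie Z Y) S) => //.
  rewrite !(prelieE _ _ (leqnn _)) -sumrB; apply: eq_bigr => A _.
  by rewrite -sumrB; apply: eq_bigr => B _; rewrite -!mulrBl -mulrBr.
move=> /eqP; rewrite subr_eq => /eqP ->.
set a := prelie (prelie X Z) Y; set b := prelie _ _; set c := prelie X _.
have -> : a - b + c - a = c - b by rewrite addrAC [a - b]addrC addrK addrC.
by rewrite subrr.
Qed.

Lemma act_Uideal X u : Uideal u -> act_tensor X u = 0.
Proof.
move=> /asboolP hu; apply/funext => S; have [r hr] := hu (nverts S).
rewrite (act_tensor_low_eq X hr) act_tensor_sum big1 // => p _.
by rewrite !act_tensor_mul act_lie_relator act_tensor0l.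
Qed.

Lemma act_pi X u : act X (\pi_(Uhat K) u) = act_tensor X u.
Proof.
apply/eqP; rewrite -subr_eq0 -act_tensorB; apply/eqP; apply: act_Uideal.
set v := repr _.
suff : v - u \in GRing.ZmodClosed.clone (That K) (@Uideal K) _ by [].
by rewrite Quotient.idealrBE reprK.
Qed.

End Linear.

Notation Qq := {fraction {poly rat}}.

Notation "p %:F" := (@FracField.tofrac _ p) : ring_scope.

Definition q : Qq := 'X%:F.

Definition regular0 (f : Qq) : Prop :=
  exists p r : {poly rat}, r.[0] != 0 /\ f = p%:F / r%:F.

Definition at0 (f : Qq) : rat :=
  xget 0 [set c : rat | exists p r : {poly rat},
    [/\ r.[0] != 0, f = p%:F / r%:F & c = p.[0] / r.[0]]].

Lemma at0E (p r : {poly rat}) : r.[0] != 0 -> at0 (p%:F / r%:F) = p.[0] / r.[0].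
Proof.
move=> r0; rewrite /at0; case: xgetP => [c _ [p' [r' [r'0 /eqP e ->]]]|]; last first.
  by move/(_ (p.[0] / r.[0])); case; exists p, r.
have nz (s : {poly rat}) : s.[0] != 0 -> s%:F != 0.
  by move=> s0; rewrite tofrac_eq0; apply: contraNneq s0 => ->; rewrite horner0.
move: e; rewrite eqr_div ?nz // -!tofracM tofrac_eq => /eqP/(congr1 (horner^~ 0)).
by rewrite !hornerM => e; apply/eqP; rewrite eqr_div // e.
Qed.

Definition PL_ext (X : PLhat rat) : PLhat Qq := fun T => ((X T)%:P)%:F.

(* A[q]: the component of degree n of A is multiplied by q ^+ n. *)
Definition PL_dilate (A : PLhat Qq) : PLhat Qq := fun T => q ^+ nverts T * A T.

(* Main.v *)
(** In degree [n] the equation for [Omega_q] expresses [(q ^+ n - 1) Omega_q]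
   through the components of [Omega_q] of degree less than [n], and
   [q ^+ n - 1] takes the value [-1] at [q = 0]. So [Omega_q] is regular at
   [q = 0]; there [Omega_q[q]] vanishes, and the equation becomes
   [Omega_0 = bullet - prelie bullet Omega_0], whose solution is the alternating
   sum of the linear trees since grafting [Lnr n] on [bullet] gives
   [Lnr n.+1]. *)
Require Import Defs.
From mathcomp Require Import all_boot all_order all_algebra.
From mathcomp Require Import all_classical.
From mathcomp Require Import zify.

Set Implicit Arguments.
Unset Strict Implicit.
Unset Printing Implicit Defensive.

Import GRing.Theory.
Local Open Scope ring_scope.
Local Open Scope quotient_scope.

(** * Rational functions with a value at [q = 0] *)

(** Regularity and value are held in one relation, so that a single closure lemma per operation
    carries both through the equation. *)
Definition val0 (f : Qq) (c : rat) : Prop := exists p r : {poly rat},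
  [/\ r.[0] != 0, f = p%:F / r%:F & c = p.[0] / r.[0]].

Lemma tofrac_horner0_neq0 (r : {poly rat}) : r.[0] != 0 -> r%:F != 0 :> Qq.
Proof. by rewrite tofrac_eq0; apply: contraNneq => ->; rewrite horner0. Qed.

Lemma val0_regular f c : val0 f c -> regular0 f.
Proof. by case=> p [r [r0 fE _]]; exists p, r. Qed.

Lemma val0_at0 f c : val0 f c -> at0 f = c.
Proof. by case=> p [r [r0 -> ->]]; exact: at0E. Qed.

Lemma val0_poly (p : {poly rat}) : val0 p%:F p.[0].
Proof.
by exists p, 1; rewrite hornerE oner_neq0 tofrac1 !divr1.
Qed.

Lemma val0C c : val0 (c%:P)%:F c.
Proof. by have := val0_poly c%:P; rewrite hornerC. Qed.

Lemma val0_0 : val0 0 0.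
Proof. by have := val0C 0; rewrite tofrac0. Qed.

Lemma val0_1 : val0 1 1.
Proof. by have := val0C 1; rewrite tofrac1. Qed.

Lemma val0_q : val0 q 0.
Proof. by have := val0_poly 'X; rewrite hornerX. Qed.

Lemma val0D f g c d : val0 f c -> val0 g d -> val0 (f + g) (c + d).
Proof.
move=> [p [r [r0 -> ->]]] [p' [r' [r'0 -> ->]]].
exists (p * r' + p' * r), (r * r'); split.
- by rewrite hornerM mulf_neq0.
- by rewrite addf_div ?tofrac_horner0_neq0 // tofracD !tofracM.
- by rewrite hornerD !hornerM addf_div.
Qed.

Lemma val0M f g c d : val0 f c -> val0 g d -> val0 (f * g) (c * d).
Proof.
move=> [p [r [r0 -> ->]]] [p' [r' [r'0 -> ->]]].
exists (p * p'), (r * r'); split.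
- by rewrite hornerM mulf_neq0.
- by rewrite mulf_div !tofracM.
- by rewrite !hornerM mulf_div.
Qed.

Lemma val0V f c : c != 0 -> val0 f c -> val0 f^-1 c^-1.
Proof.
move=> c0 [p [r [r0 fE cE]]]; exists r, p; split.
- by apply: contraNneq c0 => p0; rewrite cE p0 mul0r.
- by rewrite fE invf_div.
- by rewrite cE invf_div.
Qed.

Lemma val0N f c : val0 f c -> val0 (- f) (- c).
Proof.
move=> h; rewrite -mulN1r -[- c]mulN1r; apply: val0M => //.
by have := val0C (-1); rewrite polyCN tofracN tofrac1.
Qed.

Lemma val0B f g c d : val0 f c -> val0 g d -> val0 (f - g) (c - d).
Proof. by move=> hf /val0N; exact: val0D. Qed.

Lemma val0X f c n : val0 f c -> val0 (f ^+ n) (c ^+ n).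
Proof.
move=> h; elim: n => [|n IH]; first exact: val0_1.
by rewrite !exprS; exact: val0M.
Qed.

Lemma val0_nat n : val0 n%:R n%:R.
Proof.
elim: n => [|n IH]; first exact: val0_0.
rewrite -addn1 !natrD; exact: val0D IH val0_1.
Qed.

Lemma val0_sum (I : eqType) (r : seq I) (F : I -> Qq) (c : I -> rat) :
  (forall i, i \in r -> val0 (F i) (c i)) ->
  val0 (\sum_(i <- r) F i) (\sum_(i <- r) c i).
Proof.
move=> h; rewrite [X in val0 X]big_seq [X in val0 _ X]big_seq.
by apply: (big_ind2 val0) => [|? ? ? ?|//]; [exact: val0_0 | exact: val0D].
Qed.

(** The local ring at [q = 0]. It serves for coefficients whose value does not matter because they
    multiply something that vanishes at 0. *)
Definition integral0 (f : Qq) : Prop := exists c, val0 f c.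

Lemma integral0_sum (I : eqType) (r : seq I) (F : I -> Qq) :
  (forall i, integral0 (F i)) -> integral0 (\sum_(i <- r) F i).
Proof.
move=> h; exists (\sum_(i <- r) sval (cid (h i))).
by apply: val0_sum => i _; case: cid.
Qed.

Lemma integral0M f g : integral0 f -> integral0 g -> integral0 (f * g).
Proof. by move=> [c hc] [d hd]; exists (c * d); exact: val0M. Qed.

(** * Regularity of the coefficients of an exponential *)

Lemma integral0_tone w : integral0 (tone Qq w).
Proof. by eexists; exact: val0_nat. Qed.

Lemma integral0_tpow (u : That Qq) n w :
  (forall w, integral0 (u w)) -> integral0 (tpow u n w).
Proof.
move=> h; elim: n w => [|n IH] w; first exact: integral0_tone.
rewrite /tpow iterS /tmul; apply: integral0_sum => i.
exact: integral0M (h _) (IH _).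
Qed.

(** A tensor representing [Uexp X]: its coefficients can be examined word by word, before passing to
    the quotient. *)
Definition texp (K : fieldType) (X : PLhat K) : That K :=
  csum setT (fun n => n`!%:R^-1 \*o tpow (tinj X) n).

Lemma integral0_texp (X : PLhat Qq) w :
  (forall T, integral0 (X T)) -> integral0 (texp X w).
Proof.
(* By definition [csum] runs over a finite support, so it is an ordinary finite sum. *)
move=> h; apply: integral0_sum => n /=.
apply: integral0M.
  exists n`!%:R^-1; apply: val0V (val0_nat _).
  by rewrite Num.Theory.pnatr_eq0 -lt0n fact_gt0.
apply: integral0_tpow => -[|T [|? ?]] /=; try by exists 0; exact: val0_0.
exact: h.
Qed.

(** [tinj X] vanishes on the empty word, so only the power of exponent 0 contributes. Hence the
    exponential minus 1 has no constant term. *)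
Lemma texp_nil (K : fieldType) (X : PLhat K) : texp X [::] = 1.
Proof.
rewrite /texp (@csumE _ _ _ [:: 0%N]) //.
  by rewrite big_seq1 /= fact0 invr1 mul1r.
move=> [|n] // _ /=.
by rewrite /tmul big_ord1 /= mul0r mulr0.
Qed.

Lemma pi_UhatB (K : fieldType) (u v : That K) :
  \pi_(Uhat K) u - \pi_(Uhat K) v = \pi_(Uhat K) (u - v).
Proof. by rewrite /Uhat; rewrite !piE. Qed.

Lemma act_expB1 (K : fieldType) (X Y : PLhat K) :
  act X (Uexp Y - Uone K) = act_tensor X (texp Y - tone K).
Proof. by rewrite /Uexp /Useries /Uone pi_UhatB act_pi. Qed.

(** * Vanishing at [q = 0] in low degrees *)

Definition zero_below (d : nat) (X : PLhat Qq) : Prop :=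
  forall T, (nverts T < d)%N -> val0 (X T) 0.

Lemma val0_mult A B S : val0 (mult Qq A B S) (mult rat A B S).
Proof. by rewrite !Defs.multE; apply: val0_sum => t _; exact: val0_nat. Qed.

Lemma val0_basis T S : val0 (basis Qq T S) (basis rat T S).
Proof. exact: val0_nat. Qed.

(** The grafted tree has at least one vertex, so coefficients of the product in degree at most [d]
    involve [X] in degrees less than [d] only. *)
Lemma zero_below_prelie d X T :
  zero_below d X -> zero_below d.+1 (prelie X (basis Qq T)).
Proof.
move=> h S hS; rewrite (prelieE _ _ (leqnn _)).
have -> : 0 = \sum_(A <- trees (nverts S)) \sum_(B <- trees (nverts S)) 0 :> rat.
  by rewrite big1 // => A _; rewrite big1.
apply: val0_sum => A _; apply: val0_sum => B _.
(* Nothing is known of [X A] in large degree, not even regularity; such terms disappear because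
   their multiplicity is 0. *)
have [e|ne] := eqVneq (nverts A + nverts B)%N (nverts S); last first.
  by rewrite mult_eq0 // mulr0; exact: val0_0.
have -> : 0 = 0 * basis rat T B * mult rat A B S by rewrite !mul0r.
apply: val0M (val0_mult _ _ _); apply: val0M (val0_basis _ _).
by apply: h; have := nverts_gt0 B; lia.
Qed.

Lemma zero_below_act_word d X w :
  zero_below d X -> zero_below (d + size w) (act_word X w).
Proof.
rewrite /act_word; elim: w d X => [|T w IH] d X h /=; first by rewrite addn0.
by rewrite addnS -addSn; apply: IH; exact: zero_below_prelie.
Qed.

(** Without a constant term, [u] acts through nonempty words only, and each of these raises the
    degree by at least one. *)
Lemma zero_below_act_tensor d X u : u [::] = 0 ->
  (forall w, integral0 (u w)) -> zero_below d X ->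
  zero_below d.+1 (act_tensor X u).
Proof.
move=> u0 hu h S hS; rewrite (act_tensorE _ _ (leqnn _)).
have -> : 0 = \sum_(w <- words (nverts S)) 0 :> rat by rewrite big1.
apply: val0_sum => -[|T w] _; first by rewrite u0 mul0r; exact: val0_0.
have [c hc] := hu (T :: w); rewrite -[0](mulr0 c); apply: val0M => //.
by apply: (@zero_below_act_word _ _ (T :: w) h) => /=; lia.
Qed.

(** The left factor takes up one vertex, so only coefficients of [X] in smaller degree occur: those
    that an induction on the degree controls. *)
Lemma val0_prelie_bullet (X : PLhat Qq) (L : PLhat rat) S :
  (forall T, (nverts T < nverts S)%N -> val0 (X T) (L T)) ->
  val0 (prelie (bullet Qq) X S) (prelie (bullet rat) L S).
Proof.
move=> h; rewrite !(prelieE _ _ (leqnn _)).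
apply: val0_sum => A _; apply: val0_sum => B _.
have [e|ne] := eqVneq (nverts A + nverts B)%N (nverts S); last first.
  by rewrite !mult_eq0 // !mulr0; exact: val0_0.
apply: val0M (val0_mult _ _ _); apply: val0M (val0_basis _ _) _.
by apply: h; have := nverts_gt0 A; lia.
Qed.

(** * The alternating sum of the linear trees *)

Lemma nverts_Lnr n : (0 < n)%N -> nverts (Lnr n) = n.
Proof.
case: n => // n _; rewrite /Lnr nverts_pi /=.
by elim: n => //= n ->; rewrite addn0.
Qed.

Definition Lnr_alt : PLhat rat :=
  csum [set n : nat | (0 < n)%N]
    (fun n : nat => (-1) ^+ n.-1 \*o basis rat (Lnr n)).

Lemma Lnr_altE T :
  Lnr_alt T = (-1) ^+ (nverts T).-1 * (T == Lnr (nverts T))%:R.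
Proof.
rewrite /Lnr_alt /csum (fsbigE [:: nverts T]) //.
- by rewrite big_mkcond big_seq1 mem_set //=; exact: nverts_gt0.
- by move=> n /=; rewrite inE => /eqP ->; exact: nverts_gt0.
move=> n n0; rewrite inE /basis /= => hn.
by case: eqP => [e|]; rewrite ?mulr0 //; move: hn; rewrite e nverts_Lnr ?eqxx.
Qed.

Lemma pi_Node1_Lnr n : (0 < n)%N -> \pi_tree (Node [:: repr (Lnr n)]) = Lnr n.+1.
Proof.
case: n => // n _; rewrite [RHS]/Lnr /=; apply/eqmodP.
apply/isoP; exists [:: iter n (fun t => Node [:: t]) (Node [::])] => //=.
by rewrite iso_repr.
Qed.

(** The one-vertex tree offers a single place to graft [B], which yields the tree whose root has [B]
    as its only child. *)
Lemma prelie_bulletE (K : fieldType) (X : PLhat K) S :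
  prelie (bullet K) X S =
  \sum_(B <- trees (nverts S)) X B * (S == \pi_tree (Node [:: repr B]))%:R.
Proof.
rewrite (prelieE _ _ (leqnn _)) exchange_big /=; apply: eq_bigr => B _.
rewrite (bigD1_seq bullet_tree) ?trees_uniq ?mem_trees //=; last first.
  by rewrite nverts_pi /= nverts_gt0.
rewrite big1 => [|A /negbTE hA]; last by rewrite /bullet /basis hA !mul0r.
rewrite /bullet /basis eqxx mul1r addr0 Defs.multE; congr (_ * _).
rewrite (gsum_isor _ (iso_repr _) (delta_pi_inv K S)).
by rewrite gsum_node fgsum_nil addr0.
Qed.

(** The equation at [q = 0]: one more vertex changes the sign, and the term [bullet] accounts for
    degree 1, where no grafted tree occurs. *)
Lemma Lnr_alt_rec S :
  Lnr_alt S = bullet rat S - prelie (bullet rat) Lnr_alt S.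
Proof.
rewrite prelie_bulletE /bullet /basis.
have pos (B : tree) : S = \pi_tree (Node [:: repr B]) -> nverts S = (nverts B).+1.
  by move=> ->; rewrite nverts_pi /= addn0.
have bul1 : bullet_tree = Lnr 1 by [].
have [S1|S1] := eqVneq (nverts S) 1%N.
  rewrite Lnr_altE S1 mul1r bul1 big1 ?subr0 // => B _.
  by case: eqP => [/pos e|]; rewrite ?mulr0 //; have := nverts_gt0 B; lia.
have -> : (S == bullet_tree) = false.
  by apply: contraNF S1 => /eqP ->; rewrite bul1 nverts_Lnr.
have [n [n0 nS]] : exists n, (0 < n)%N /\ nverts S = n.+1.
  by exists (nverts S).-1; have := nverts_gt0 S; lia.
(* A tree [B] that contributes has [n] vertices, and among these [Lnr_alt] is nonzero at [Lnr n]
   only. *)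
rewrite sub0r (bigD1_seq (Lnr n)) ?trees_uniq ?mem_trees ?nverts_Lnr //=; last first.
  by rewrite nS.
rewrite big1 => [|B /negbTE hB]; last first.
  case: eqP => [/pos e|]; rewrite ?mulr0 // Lnr_altE.
  have <- : n = nverts B by lia.
  by rewrite hB mulr0 mul0r.
rewrite addr0 pi_Node1_Lnr // !Lnr_altE nverts_Lnr // eqxx mulr1 nS /=.
by rewrite -mulNr; congr (_ * _); case: n n0 {nS} => // n _; rewrite exprS mulN1r.
Qed.

(** * Solving the equation by induction on the degree *)

Lemma val0_Omega_q (Omega : PLhat rat) (Omega_q : PLhat Qq) :
  act (PL_dilate Omega_q) (Uexp (PL_ext Omega) - Uone Qq)
    + PL_dilate Omega_q - Omega_q
  = prelie (bullet Qq) Omega_q + (q - 1) \*o bullet Qq ->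
  forall T, val0 (Omega_q T) (Lnr_alt T).
Proof.
rewrite act_expB1; set u := texp _ - _ => eqn T.
have u0 : u [::] = 0.
  by rewrite -[LHS]/(texp _ [::] - 1) texp_nil subrr.
have hu w : integral0 (u w).
  have [c hc] : integral0 (texp (PL_ext Omega) w).
    by apply: integral0_texp => S; eexists; exact: val0C.
  by have [d hd] := integral0_tone w; exists (c - d); exact: val0B.
elim/ltn_ind: (nverts T) {-2}T (erefl (nverts T)) => n IH {}T nT.
(* Trees have at least one vertex, so the factor [q ^+ nverts S] vanishes at 0; the induction
   hypothesis makes the other factor regular. *)
have dil0 : zero_below n (PL_dilate Omega_q).
  move=> S hS; rewrite -[0](mul0r (Lnr_alt S)); apply: val0M; last exact: IH hS _ _.
  by have := val0X (nverts S) val0_q; rewrite expr0n gtn_eqF ?nverts_gt0.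
(* The action gains one degree, which extends the vanishing from degrees below [n] to degree [n]
   itself. *)
have act0 : val0 (act_tensor (PL_dilate Omega_q) u T) 0.
  by apply: zero_below_act_tensor u0 hu dil0 _ _; rewrite nT.
have pre : val0 (prelie (bullet Qq) Omega_q T) (prelie (bullet rat) Lnr_alt T).
  by apply: val0_prelie_bullet => S hS; apply: (IH (nverts S)) => //; rewrite -nT.
have eqT : act_tensor (PL_dilate Omega_q) u T + q ^+ n * Omega_q T - Omega_q T =
    prelie (bullet Qq) Omega_q T + (q - 1) * bullet Qq T.
  by rewrite -nT; exact: (congr1 (fun X : PLhat Qq => X T) eqn).
have qn1 : val0 (q ^+ n - 1) (-1).
  rewrite -(sub0r (1 : rat)); apply: val0B val0_1.
  by have := val0X n val0_q; rewrite expr0n gtn_eqF // -nT nverts_gt0.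
have qn_neq0 : q ^+ n - 1 != 0.
  apply/eqP => e; have := val0_at0 qn1; rewrite e (val0_at0 val0_0) => /eqP.
  by rewrite eq_sym oppr_eq0 oner_eq0.
(* The equation is solved for [Omega_q T]; the divisor [q ^+ n - 1] is a unit of the local ring at
   0. *)
have -> : Omega_q T = (prelie (bullet Qq) Omega_q T + (q - 1) * bullet Qq T
    - act_tensor (PL_dilate Omega_q) u T) * (q ^+ n - 1)^-1.
  apply: (canRL (mulfK qn_neq0)).
  by rewrite -eqT addrAC [X in X - Omega_q T]addrAC subrr add0r mulrBr mulr1 mulrC.
(* The recursion for [Lnr_alt] is put in the same shape, each factor replaced by its value at 0, so
   that the closure lemmas apply term by term. *)
have -> : Lnr_alt T = (prelie (bullet rat) Lnr_alt T + (0 - 1) * bullet rat T - 0)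
    * (-1)^-1.
  by rewrite [LHS]Lnr_alt_rec invrN1 mulrN1 subr0 sub0r mulN1r opprB.
apply: val0M; last by apply: val0V qn1; rewrite oppr_eq0 oner_eq0.
apply: val0B act0; apply: val0D pre _; apply: val0M (val0_basis _ _).
exact: val0B val0_q val0_1.
Qed.

Theorem mainTheorem4 (Omega : PLhat rat) (Omega_q : PLhat Qq)
  (hOmega : act (bullet rat) (Useries (todd rat) Omega) = Omega)
  (hOmega_q :
     act (PL_dilate Omega_q) (Uexp (PL_ext Omega) - Uone Qq)
       + PL_dilate Omega_q - Omega_q
     = prelie (bullet Qq) Omega_q + (q - 1) \*o bullet Qq) :
  (forall T : tree, regular0 (Omega_q T)) /\
  (fun T : tree => at0 (Omega_q T))
    = csum [set n : nat | (0 < n)%N]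
        (fun n : nat => (-1) ^+ n.-1 \*o basis rat (Lnr n)).
Proof.
have h := val0_Omega_q hOmega_q.
split=> [T|]; first exact: val0_regular (h T).
by apply/funext => T; exact: val0_at0 (h T).
Qed.
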